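(* Let $k$ be a field. The morphism of $\mathbb S$-modules $sh=\bigoplus_{n\ge1}sh_n:\mathrm{As}\to\mathrm{As}$, given in arity $n$ by left multiplication by $sh_n\in k\mathbb S_n$ on $\mathrm{As}(n)\cong k\mathbb S_n$, is also a morphism of $\mathrm{Lie}$-bimodules.
   Context: $\mathrm{As}$ is the operad of (non-unital) associative algebras: $\mathrm{As}(n)\cong k\mathbb S_n$, where $\sigma\in\mathbb S_n$ corresponds to the multilinear monomial $x_{\sigma(1)}x_{\sigma(2)}\cdots x_{\sigma(n)}$; the right $\mathbb S_n$-action relabels variables. The product in $\mathbb S_n$ is taken so that $(\sigma\tau)(k)=\tau(\sigma(k))$, so the right action is right multiplication and left multiplication by $\sigma$ permutes positions. For $A\subseteq[n]=\{1,\dots,n\}$ with $A=\{i_1<\dots<i_p\}$ and $[n]\setminus A=\{j_1<\dots<j_q\}$, let $\sigma_A\in\mathbb S_n$ be $\sigma_A(k)=i_k$ for $k\le p$ and $\sigma_A(k)=j_{k-p}$ for $k>p$. Put $sh_n=\sum_{A\subseteq[n]}\sigma_A\in k\mathbb S_n$. Thus $sh_n$ acts on $\mathrm{As}(n)$ by $x_{w(1)}\cdots x_{w(n)}\mapsto\sum_{A\subseteq[n]}x_{w(\sigma_A(1))}\cdots x_{w(\sigma_A(n))}$. $\mathrm{As}$ is a $\mathrm{Lie}$-bimodule via the operad map $\mathrm{Lie}\to\mathrm{As}$ sending the bracket $l$ to $x_1x_2-x_2x_1$. Here a bimodule over an operad $\mathcal O$ is an $\mathbb S$-module $\mathcal M$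 with associative, compatible actions $\mathcal M\circ_1\mathcal O\to\mathcal M$ and $\mathcal O\circ_1\mathcal M\to\mathcal M$ by partial compositions (the left action being linear in $\mathcal M$: one element of $\mathcal M$ is inserted in one input of an element of $\mathcal O$), where $(\mathcal A\circ_1\mathcal B)(X)=\bigoplus_{Y\subseteq X}\mathcal A((X\setminus Y)\amalg\{\ast\})\otimes\mathcal B(Y)$. *)

(* Defs.v *)
From HB Require Import structures.
From mathcomp Require Import all_boot all_algebra all_fingroup.
From mathcomp Require Import generic_quotient ring.
From mathcomp Require Import boolp.
Set Implicit Arguments.
Unset Strict Implicit.
Unset Printing Implicit Defensive.
Import GRing.Theory.
Local Open Scope ring_scope.
Local Open Scope quotient_scope.

Record bij (X Y : Type) := Bij {
  bij_fun :> X -> Y;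
  bij_inv : Y -> X;
  bij_funK : cancel bij_fun bij_inv;
  bij_invK : cancel bij_inv bij_fun }.

Lemma bij_eq X Y (f g : bij X Y) : f =1 g -> f = g.
Proof.
case: f g => [f f' fK f'K] [g g' gK g'K] /= /funext efg.
rewrite -{}efg in gK g'K *.
have e : f' = g' by apply/funext => y; rewrite -[y in LHS]g'K fK.
rewrite -{}e in gK g'K *.
by rewrite (Prop_irrelevance gK fK) (Prop_irrelevance g'K f'K).
Qed.

Definition bij_id X : bij X X := @Bij X X id id (frefl _) (frefl _).

Definition bij_compose X Y Z (g : bij Y Z) (f : bij X Y) : bij X Z :=
  Bij (can_comp (bij_funK g) (bij_funK f)) (can_comp (bij_invK f) (bij_invK g)).

Definition bij_sym X Y (f : bij X Y) : bij Y X := Bij (bij_invK f) (bij_funK f).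

Definition bij_enum (T : finType) : bij T 'I_#|T| :=
  Bij (@enum_rankK T) (@enum_valK T).

Definition bij_perm (T : finType) (s : {perm T}) : bij T T :=
  Bij (permK s) (permKV s).

Section StandardBijections.
Context {X Y Z X' Y' : Type}.

Definition bij_option (f : bij X Y) : bij (option X) (option Y).
Proof.
by exists (omap f) (omap (bij_inv f)); case=> //= x; rewrite (bij_funK, bij_invK).
Defined.

Definition bij_sum (f : bij X X') (g : bij Y Y') : bij (X + Y) (X' + Y').
Proof.
exists (fun z => match z with inl x => inl (f x) | inr y => inr (g y) end)
  (fun z => match z with inl x => inl (bij_inv f x) | inr y => inr (bij_inv g y) end);
by case=> x; rewrite (bij_funK, bij_invK).
Defined.

Definition bij_sumA : bij (X + Y + Z) (X + (Y + Z)).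
Proof.
exists (fun z => match z with inl (inl x) => inl x
                         | inl (inr y) => inr (inl y) | inr z => inr (inr z) end)
  (fun z => match z with inl x => inl (inl x)
                    | inr (inl y) => inl (inr y) | inr (inr z) => inr z end);
by do 2?case.
Defined.

Definition bij_sumC : bij (X + Y) (Y + X).
Proof.
exists (fun z => match z with inl x => inr x | inr y => inl y end)
  (fun z => match z with inl y => inr y | inr x => inl x end);
by do 2?case.
Defined.

Definition bij_sumAC : bij (X + Y + Z) (X + Z + Y).
Proof.
exists (fun z => match z with inl (inl x) => inl (inl x)
                         | inl (inr y) => inr y | inr z => inl (inr z) end)
  (fun z => match z with inl (inl x) => inl (inl x)
                    | inl (inr z) => inr z | inr y => inl (inr y) end);
by do 2?case.
Defined.

Definition bij_sum_optionl : bij (option X + Y) (option (X + Y)).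
Proof.
exists (fun z => match z with inl o => omap inl o | inr y => Some (inr y) end)
  (fun o => match o with None => inl None | Some (inl x) => inl (Some x)
                    | Some (inr y) => inr y end);
by do 2?case.
Defined.

Definition bij_sum_optionr : bij (X + option Y) (option (X + Y)).
Proof.
exists (fun z => match z with inl x => Some (inl x) | inr o => omap inr o end)
  (fun o => match o with None => inr None | Some (inl x) => inl x
                    | Some (inr y) => inr (Some y) end);
by do 2?case.
Defined.

Definition bij_option_swap : bij (option (option X)) (option (option X)).
Proof.
pose s (o : option (option X)) : option (option X) :=
  match o with None => Some None | Some None => None | _ => o end.
by exists s s; do 2?case.
Defined.

Definition bij_sum_unit : bij (X + unit) (option X).
Proof.
exists (fun z => match z with inl x => Some x | inr _ => None end)
  (fun o => match o with Some x => inl x | None => inr tt end);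
by do 2?case.
Defined.

Definition bij_void_sum : bij (void + Y) Y.
Proof.
by exists (fun z => match z with inl x => of_void _ x | inr y => y end) inr;
  do 2?case.
Defined.

End StandardBijections.

Definition bij_unit_option : bij unit (option void).
Proof. by exists (fun _ => None) (fun _ => tt); do 2?case. Defined.

Definition bij_ord_option n : bij 'I_n.+1 (option 'I_n).
Proof.
exists (unlift ord0) (oapp (lift ord0) ord0).
- by move=> i; case: unliftP.
- by case=> [i|] /=; rewrite ?liftK ?unlift_none.
Defined.

Definition bij_sum_ord m n : bij ('I_m + 'I_n) 'I_(m + n) :=
  Bij (@unsplitK m n) (@splitK m n).

Definition bij_ordS n : bij 'I_n 'I_n := Bij (@ordSK n) (@ord_predK n).

(* S-modules, presented as functors from finite sets and bijections: the value
   at 'I_n is the component of arity n.  Since (s * t) i = t (s i) for s and t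
   in 'S_n, functoriality makes 'S_n act on it on the right. *)
Record smodule (k : fieldType) := Smodule {
  sm_sort :> finType -> lmodType k;
  sm_act : forall X Y : finType, bij X Y -> sm_sort X -> sm_sort Y;
  sm_act_linear : forall (X Y : finType) (f : bij X Y), linear (sm_act f);
  sm_act_id : forall (X : finType) (a : sm_sort X), sm_act (bij_id X) a = a;
  sm_act_comp : forall (X Y Z : finType) (g : bij Y Z) (f : bij X Y) a,
    sm_act (bij_compose g f) a = sm_act g (sm_act f a) }.

Definition is_smodule_mor k (M N : smodule k) (f : forall X, M X -> N X) : Prop :=
  (forall X, linear (f X)) /\
  (forall (X Y : finType) (g : bij X Y) a, f Y (sm_act g a) = sm_act g (f X a)).

Section PartialComposition.
Context {k : fieldType}.
Implicit Types A B C D E F : smodule k.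

(* The data of a map from the infinitesimal composite of A and B to C; the
   input of A into which B is inserted is None. *)
Definition icomp A B C := forall X Y : finType,
  A (option X) -> B Y -> C (X + Y)%type.

Definition icomp_bilinear A B C (c : icomp A B C) : Prop :=
  forall X Y, (forall b, linear (fun a => c X Y a b)) /\
              (forall a, linear (c X Y a)).

Definition icomp_natural A B C (c : icomp A B C) : Prop :=
  forall (X Y X' Y' : finType) (f : bij X X') (g : bij Y Y') a b,
    c X' Y' (sm_act (bij_option f) a) (sm_act g b) =
    sm_act (bij_sum f g) (c X Y a b).

(* (a o b) o c = a o (b o c), where c is inserted in an input of b *)
Definition icomp_seq A B C D E F (cAB : icomp A B D) (cDC : icomp D C E)
    (cBC : icomp B C F) (cAF : icomp A F E) : Prop :=
  forall (X Y Z : finType) (a : A (option X)) (b : B (option Y)) (c : C Z),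
    sm_act bij_sumA (cDC _ Z (sm_act bij_sum_optionr (cAB X _ a b)) c) =
    cAF X _ a (cBC Y Z b c).

(* (a o b) o c = (a o c) o b, where b and c are inserted in two distinct
   inputs of a *)
Definition icomp_par A B C D E F (cAB : icomp A B D) (cDC : icomp D C E)
    (cAC : icomp A C F) (cFB : icomp F B E) : Prop :=
  forall (X Y Z : finType) (a : A (option (option X))) (b : B Y) (c : C Z),
    sm_act bij_sumAC (cDC _ Z (sm_act bij_sum_optionl (cAB _ Y a b)) c) =
    cFB _ Y (sm_act bij_sum_optionl (cAC _ Z (sm_act bij_option_swap a) c)) b.

Definition icomp_unitr A (U : smodule k) (u : U unit) (c : icomp A U A) : Prop :=
  forall (X : finType) (a : A (option X)), sm_act bij_sum_unit (c X _ a u) = a.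

Definition icomp_unitl (U : smodule k) A (u : U unit) (c : icomp U A A) : Prop :=
  forall (Y : finType) (a : A Y),
    sm_act bij_void_sum (c void Y (sm_act bij_unit_option u) a) = a.

End PartialComposition.

Record operad (k : fieldType) := Operad {
  op_smodule :> smodule k;
  op_one : op_smodule unit;
  op_comp : icomp op_smodule op_smodule op_smodule;
  op_bilinear : icomp_bilinear op_comp;
  op_natural : icomp_natural op_comp;
  op_unitl : icomp_unitl op_one op_comp;
  op_unitr : icomp_unitr op_one op_comp;
  op_seq : icomp_seq op_comp op_comp op_comp op_comp;
  op_par : icomp_par op_comp op_comp op_comp op_comp }.

Record operad_mor k (P Q : operad k) := OperadMor {
  om_fun :> forall X : finType, P X -> Q X;
  om_smodule : is_smodule_mor om_fun;
  om_one : om_fun (op_one P) = op_one Q;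
  om_comp : forall (X Y : finType) (a : P (option X)) (b : P Y),
    om_fun (op_comp a b) = op_comp (om_fun a) (om_fun b) }.

Record bimodule k (P : operad k) := Bimodule {
  bm_smodule :> smodule k;
  bm_left : icomp P bm_smodule bm_smodule;
  bm_right : icomp bm_smodule P bm_smodule;
  bm_left_bilinear : icomp_bilinear bm_left;
  bm_right_bilinear : icomp_bilinear bm_right;
  bm_left_natural : icomp_natural bm_left;
  bm_right_natural : icomp_natural bm_right;
  bm_left_unit : icomp_unitl (op_one P) bm_left;
  bm_right_unit : icomp_unitr (op_one P) bm_right;
  bm_left_seq : icomp_seq (@op_comp k P) bm_left bm_left bm_left;
  bm_left_right_seq : icomp_seq bm_left bm_right bm_right bm_left;
  bm_right_seq : icomp_seq bm_right bm_right (@op_comp k P) bm_right;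
  bm_left_right_par : icomp_par bm_left bm_right (@op_comp k P) bm_left;
  bm_right_par : icomp_par bm_right bm_right bm_right bm_right }.

Definition is_bimodule_mor k (P : operad k) (M N : bimodule P)
    (f : forall X, M X -> N X) : Prop :=
  [/\ is_smodule_mor f,
      forall (X Y : finType) (p : P (option X)) (m : M Y),
        f _ (bm_left p m) = bm_left p (f _ m) &
      forall (X Y : finType) (m : M (option X)) (p : P Y),
        f _ (bm_right m p) = bm_right (f _ m) p].

Definition operad_bimodule k (P : operad k) : bimodule P :=
  @Bimodule k P P (@op_comp k P) (@op_comp k P)
    (@op_bilinear k P) (@op_bilinear k P) (@op_natural k P) (@op_natural k P)
    (@op_unitl k P) (@op_unitr k P)
    (@op_seq k P) (@op_seq k P) (@op_seq k P) (@op_par k P) (@op_par k P).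

Section Restriction.
Context {k : fieldType} {P Q : operad k} (phi : operad_mor P Q) (M : bimodule Q).

Let left : icomp P M M := fun X Y p m => bm_left (phi _ p) m.
Let right : icomp M P M := fun X Y m p => bm_right m (phi _ p).

Definition bimodule_restrict : bimodule P.
Proof.
exists M left right; rewrite /left /right;
  have [philin phiact] := om_smodule phi.
- move=> X Y; split=> [b|a] c u v.
    by rewrite philin (bm_left_bilinear M X Y).1.
  by rewrite (bm_left_bilinear M X Y).2.
- move=> X Y; split=> [b|a] c u v.
    by rewrite (bm_right_bilinear M X Y).1.
  by rewrite philin (bm_right_bilinear M X Y).2.
- by move=> X Y X' Y' f g a b; rewrite phiact bm_left_natural.
- by move=> X Y X' Y' f g a b; rewrite phiact bm_right_natural.
- by move=> Y a; rewrite phiact om_one bm_left_unit.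
- by move=> X a; rewrite om_one bm_right_unit.
- by move=> X Y Z a b c; rewrite phiact om_comp bm_left_seq.
- by move=> X Y Z a b c; rewrite bm_left_right_seq.
- by move=> X Y Z a b c; rewrite om_comp bm_right_seq.
- by move=> X Y Z a b c; rewrite phiact om_comp phiact bm_left_right_par.
- by move=> X Y Z a b c; rewrite bm_right_par.
Defined.

End Restriction.

(* [[x1, x2], x3] when l is the bracket [x1, x2] *)
Definition double_bracket k (P : operad k) (l : P 'I_2) : P 'I_3 :=
  sm_act (bij_compose (bij_sum_ord 2 1) bij_sumC)
    (op_comp (sm_act (bij_ord_option 1) l) l).

Definition is_Lie_bracket k (P : operad k) (l : P 'I_2) : Prop :=
  let b := double_bracket l in
  let cyc := sm_act (s := P) (bij_ordS 3) in
  sm_act (bij_perm (tperm ord0 ord_max)) l = - l /\ b + cyc b + cyc (cyc b) = 0.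

(* The operad Lie is presented by a generator of arity 2 and the relations of
   is_Lie_bracket: its elements are the expressions in the generator and the
   operad operations, modulo the equalities that hold in every operad in which
   the generator is interpreted by a Lie bracket.  Relabellings are pushed to
   the outermost operation of each summand, and compositions are over ordinals
   so that the type of expressions stays in the universe of its leaves. *)
Inductive Lie_term (k : fieldType) (X : finType) : Type :=
| LieGen : bij 'I_2 X -> Lie_term k X
| LieOne : bij unit X -> Lie_term k X
| LieZero : Lie_term k X
| LieAdd : Lie_term k X -> Lie_term k X -> Lie_term k X
| LieScale : k -> Lie_term k X -> Lie_term k X
| LieComp (m n : nat) : bij ('I_m + 'I_n)%type X ->
    Lie_term k (option 'I_m) -> Lie_term k 'I_n -> Lie_term k X.
Arguments LieGen {k X}.
Arguments LieOne {k X}.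
Arguments LieZero {k X}.

Fixpoint Lie_eval k (P : operad k) (l : P 'I_2) (X : finType)
    (t : Lie_term k X) : P X :=
  match t with
  | LieGen f => sm_act f l
  | LieOne f => sm_act f (op_one P)
  | LieZero => 0
  | LieAdd t u => Lie_eval l t + Lie_eval l u
  | LieScale c t => c *: Lie_eval l t
  | LieComp _ _ f t u => sm_act f (op_comp (Lie_eval l t) (Lie_eval l u))
  end.

Fixpoint Lie_relabel k (X Y : finType) (f : bij X Y) (t : Lie_term k X) :
    Lie_term k Y :=
  match t with
  | LieGen g => LieGen (bij_compose f g)
  | LieOne g => LieOne (bij_compose f g)
  | LieZero => LieZero
  | LieAdd t u => LieAdd (Lie_relabel f t) (Lie_relabel f u)
  | LieScale c t => LieScale c (Lie_relabel f t)
  | LieComp _ _ g t u => LieComp (bij_compose f g) t u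
  end.

Definition Lie_graft k (X Y : finType) (t : Lie_term k (option X))
    (u : Lie_term k Y) : Lie_term k (X + Y)%type :=
  LieComp (bij_sum (bij_sym (bij_enum X)) (bij_sym (bij_enum Y)))
    (Lie_relabel (bij_option (bij_enum X)) t) (Lie_relabel (bij_enum Y) u).

Section LinearFacts.
Context {k : fieldType} {U V : lmodType k} {f : U -> V} (f_lin : linear f).
Lemma lin0 : f 0 = 0.
Proof. by have:= f_lin (-1) 0 0; rewrite scaler0 addr0 scaleN1r addNr. Qed.
Lemma linZ c u : f (c *: u) = c *: f u.
Proof. by have:= f_lin c u 0; rewrite lin0 !addr0. Qed.
Lemma linD u v : f (u + v) = f u + f v.
Proof. by have:= f_lin 1 u v; rewrite !scale1r. Qed.
Lemma lin_sum (I : finType) (F : I -> U) : f (\sum_i F i) = \sum_i f (F i).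
Proof. exact: (big_morph f linD lin0). Qed.
End LinearFacts.

Lemma sm_act0 k (M : smodule k) (X Y : finType) (f : bij X Y) :
  sm_act f (0 : M X) = 0.
Proof. exact: (lin0 (sm_act_linear f)). Qed.

Lemma Lie_eval_relabel k (P : operad k) (l : P 'I_2) (X Y : finType)
    (f : bij X Y) (t : Lie_term k X) :
  Lie_eval l (Lie_relabel f t) = sm_act f (Lie_eval l t).
Proof.
elim: t Y f => {X} [X g|X g|X|X t ht u hu|X c t ht|X m n g t _ u _] Y f /=;
  rewrite ?sm_act_comp //.
- by rewrite sm_act0.
- by rewrite ht hu (linD (sm_act_linear f)).
- by rewrite ht (linZ (sm_act_linear f)).
Qed.

Lemma Lie_eval_graft k (P : operad k) (l : P 'I_2) (X Y : finType)
    (t : Lie_term k (option X)) (u : Lie_term k Y) :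
  Lie_eval l (Lie_graft t u) = op_comp (Lie_eval l t) (Lie_eval l u).
Proof.
rewrite /= !Lie_eval_relabel op_natural -sm_act_comp -[RHS]sm_act_id.
by congr sm_act; apply: bij_eq => -[x|x] /=; rewrite enum_rankK.
Qed.

Definition Lie_eqv k X (t u : Lie_term k X) : Prop :=
  forall (P : operad k) (l : P 'I_2), is_Lie_bracket l ->
  Lie_eval l t = Lie_eval l u.

Section LieQuotient.
Context {k : fieldType} {X : finType}.

HB.instance Definition _ := gen_eqMixin (Lie_term k X).
HB.instance Definition _ := gen_choiceMixin (Lie_term k X).

Definition Lie_rel : rel (Lie_term k X) := fun t u => `[< Lie_eqv t u >].

Lemma Lie_rel_equiv : equiv_class_of Lie_rel.
Proof.
split=> [t|t u|u t v]; first by apply/asboolP.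
- by apply/asboolP/asboolP => h P l hl; rewrite h.
- by move=> /asboolP h1 /asboolP h2; apply/asboolP => P l hl; rewrite h1 // h2.
Qed.

Canonical Lie_equiv := EquivRelPack Lie_rel_equiv.

Canonical Lie_encModRel := defaultEncModRel Lie_rel.

Definition Lie_type := {eq_quot Lie_rel}.

HB.instance Definition _ := Choice.on Lie_type.

Definition Lie_class (t : Lie_term k X) : Lie_type := \pi_Lie_type t.
Definition Lie_repr (x : Lie_type) : Lie_term k X := repr x.

Definition Lie_value (P : operad k) (l : P 'I_2) (x : Lie_type) : P X :=
  Lie_eval l (Lie_repr x).

Lemma Lie_valueE (P : operad k) (l : P 'I_2) : is_Lie_bracket l ->
  forall t, Lie_value l (Lie_class t) = Lie_eval l t.
Proof.
move=> hl t; rewrite /Lie_value /Lie_repr /Lie_class.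
by case: piP => u /eqmodP /asboolP /(_ P l hl) ->.
Qed.

Lemma Lie_ext (x y : Lie_type) :
  (forall (P : operad k) (l : P 'I_2), is_Lie_bracket l ->
    Lie_value l x = Lie_value l y) -> x = y.
Proof.
rewrite -[x]reprK -[y]reprK => h; apply/eqmodP/asboolP => P l hl.
by have:= h P l hl; rewrite !Lie_valueE.
Qed.

Definition Lie_add x y := Lie_class (LieAdd (Lie_repr x) (Lie_repr y)).
Definition Lie_scale c x := Lie_class (LieScale c (Lie_repr x)).
Definition Lie_opp x := Lie_scale (-1) x.
Definition Lie_zero := Lie_class LieZero.

Lemma Lie_value0 (P : operad k) (l : P 'I_2) (hl : is_Lie_bracket l) :
  Lie_value l Lie_zero = 0.
Proof. by rewrite Lie_valueE. Qed.

Lemma Lie_valueD (P : operad k) (l : P 'I_2) (hl : is_Lie_bracket l) x y :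
  Lie_value l (Lie_add x y) = Lie_value l x + Lie_value l y.
Proof. by rewrite Lie_valueE. Qed.

Lemma Lie_valueZ (P : operad k) (l : P 'I_2) (hl : is_Lie_bracket l) c x :
  Lie_value l (Lie_scale c x) = c *: Lie_value l x.
Proof. by rewrite Lie_valueE. Qed.

Definition Lie_valE := (Lie_value0, Lie_valueD, Lie_valueZ).

Lemma Lie_addA : associative Lie_add.
Proof. by move=> x y z; apply: Lie_ext => P l hl; rewrite !Lie_valE // addrA. Qed.
Lemma Lie_addC : commutative Lie_add.
Proof. by move=> x y; apply: Lie_ext => P l hl; rewrite !Lie_valE // addrC. Qed.
Lemma Lie_add0 : left_id Lie_zero Lie_add.
Proof. by move=> x; apply: Lie_ext => P l hl; rewrite !Lie_valE // add0r. Qed.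
Lemma Lie_addN : left_inverse Lie_zero Lie_opp Lie_add.
Proof.
by move=> x; apply: Lie_ext => P l hl; rewrite !Lie_valE // scaleN1r addNr.
Qed.

HB.instance Definition _ :=
  GRing.isZmodule.Build Lie_type Lie_addA Lie_addC Lie_add0 Lie_addN.

Lemma Lie_scaleA a b x : Lie_scale a (Lie_scale b x) = Lie_scale (a * b) x.
Proof. by apply: Lie_ext => P l hl; rewrite !Lie_valE // scalerA. Qed.
Lemma Lie_scale1 : left_id 1 Lie_scale.
Proof. by move=> x; apply: Lie_ext => P l hl; rewrite !Lie_valE // scale1r. Qed.
Lemma Lie_scaleDr : right_distributive Lie_scale +%R.
Proof. by move=> a x y; apply: Lie_ext => P l hl; rewrite !Lie_valE // scalerDr. Qed.
Lemma Lie_scaleDl x : {morph Lie_scale^~ x : a b / a + b}.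
Proof. by move=> a b; apply: Lie_ext => P l hl; rewrite !Lie_valE // scalerDl. Qed.

HB.instance Definition _ := GRing.Zmodule_isLmodule.Build k Lie_type
  Lie_scaleA Lie_scale1 Lie_scaleDr Lie_scaleDl.

Lemma Lie_value_linear (P : operad k) (l : P 'I_2) (hl : is_Lie_bracket l) :
  linear (Lie_value l).
Proof. by move=> a x y; rewrite !Lie_valE. Qed.

End LieQuotient.
Arguments Lie_type : clear implicits.

Section LieOperad.
Variable k : fieldType.

Definition Lie_act (X Y : finType) (f : bij X Y) (x : Lie_type k X) :
  Lie_type k Y := Lie_class (Lie_relabel f (Lie_repr x)).

Lemma Lie_value_act (P : operad k) (l : P 'I_2) (hl : is_Lie_bracket l)
    (X Y : finType) (f : bij X Y) x :
  Lie_value l (Lie_act f x) = sm_act f (Lie_value l x).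
Proof. by rewrite Lie_valueE // Lie_eval_relabel. Qed.

Definition Lie_smodule : smodule k.
Proof.
exists (fun X => Lie_type k X) Lie_act.
- move=> X Y f a x y; apply: Lie_ext => P l hl.
  by rewrite Lie_value_act // !(Lie_value_linear hl) sm_act_linear !Lie_value_act.
- by move=> X x; apply: Lie_ext => P l hl; rewrite Lie_value_act // sm_act_id.
- move=> X Y Z g f x; apply: Lie_ext => P l hl.
  by rewrite !Lie_value_act // sm_act_comp.
Defined.

Definition Lie_one : Lie_smodule unit := Lie_class (LieOne (bij_id unit)).

Definition Lie_comp : icomp Lie_smodule Lie_smodule Lie_smodule :=
  fun X Y x y => Lie_class (Lie_graft (Lie_repr x) (Lie_repr y)).

Lemma Lie_value_comp (P : operad k) (l : P 'I_2) (hl : is_Lie_bracket l)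
    (X Y : finType) x y :
  Lie_value l (@Lie_comp X Y x y) = op_comp (Lie_value l x) (Lie_value l y).
Proof. by rewrite Lie_valueE // Lie_eval_graft. Qed.

Lemma Lie_value_one (P : operad k) (l : P 'I_2) (hl : is_Lie_bracket l) :
  Lie_value l Lie_one = op_one P.
Proof. by rewrite Lie_valueE //= sm_act_id. Qed.

Definition Lie : operad k.
Proof.
exists Lie_smodule Lie_one Lie_comp.
- move=> X Y; split=> [y|x] a u v; apply: Lie_ext => P l hl.
    rewrite Lie_value_comp // !(Lie_value_linear hl) (op_bilinear P X Y).1.
    by rewrite !Lie_value_comp.
  rewrite Lie_value_comp // !(Lie_value_linear hl) (op_bilinear P X Y).2.
  by rewrite !Lie_value_comp.
- move=> X Y X' Y' f g a b; apply: Lie_ext => P l hl /=.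
  by rewrite !(Lie_value_comp, Lie_value_act) // op_natural.
- move=> Y a; apply: Lie_ext => P l hl /=.
  by rewrite !(Lie_value_comp, Lie_value_act, Lie_value_one) // op_unitl.
- move=> X a; apply: Lie_ext => P l hl /=.
  by rewrite !(Lie_value_comp, Lie_value_act, Lie_value_one) // op_unitr.
- move=> X Y Z a b c; apply: Lie_ext => P l hl /=.
  by rewrite !(Lie_value_comp, Lie_value_act) // op_seq.
- move=> X Y Z a b c; apply: Lie_ext => P l hl /=.
  by rewrite !(Lie_value_comp, Lie_value_act) // op_par.
Defined.

Definition Lie_gen : Lie 'I_2 := Lie_class (LieGen (bij_id 'I_2)).

Lemma Lie_value_gen (P : operad k) (l : P 'I_2) (hl : is_Lie_bracket l) :
  Lie_value l Lie_gen = l.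
Proof. by rewrite Lie_valueE //= sm_act_id. Qed.

Definition Lie_lift (P : operad k) (l : P 'I_2) (hl : is_Lie_bracket l) :
  operad_mor Lie P.
Proof.
exists (fun X => @Lie_value k X P l).
- split=> [X|X Y f x]; [exact: Lie_value_linear | exact: Lie_value_act].
- exact: Lie_value_one.
- exact: Lie_value_comp.
Defined.

Lemma Lie_gen_bracket : is_Lie_bracket Lie_gen.
Proof.
split; apply: Lie_ext => P l hl.
  have [anti _] := hl.
  rewrite Lie_value_act // -[- Lie_gen]scaleN1r -[_ *: _]addr0.
  rewrite (Lie_value_linear hl) (Lie_value0 hl) addr0 scaleN1r.
  by rewrite !Lie_value_gen.
have [_ jac] := hl.
have vD (X : finType) (x y : Lie X) :
    Lie_value l (x + y) = Lie_value l x + Lie_value l y by exact: Lie_valueD.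
have vb : Lie_value l (double_bracket Lie_gen) = double_bracket l.
  by rewrite !(Lie_value_act, Lie_value_comp, Lie_value_gen).
move: (double_bracket Lie_gen) vb => b vb.
rewrite !vD; do ?rewrite Lie_value_act //.
by rewrite vb jac Lie_value0.
Qed.

Lemma Lie_lift_gen (P : operad k) (l : P 'I_2) (hl : is_Lie_bracket l) :
  Lie_lift hl _ Lie_gen = l.
Proof. exact: Lie_value_gen. Qed.

Lemma Lie_lift_unique (P : operad k) (l : P 'I_2) (hl : is_Lie_bracket l)
    (phi : operad_mor Lie P) :
  phi _ Lie_gen = l -> forall (X : finType) (x : Lie X), phi X x = Lie_lift hl X x.
Proof.
move=> phil X x; rewrite -[x]reprK -[LHS]/(phi X (Lie_class (Lie_repr x))).
rewrite -[RHS]/(Lie_value l (Lie_class (Lie_repr x))) Lie_valueE //.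
have [philin phiact] := om_smodule phi.
have phi0 Y : phi Y 0 = 0 by exact: (lin0 (philin Y)).
elim: (Lie_repr x) => {X x} [X f|X f|X|X t ht u hu|X c t ht|X m n f t ht u hu] /=.
- rewrite -phil -phiact; congr (phi _ _).
  by apply: Lie_ext => Q p hp; rewrite Lie_value_act // Lie_value_gen ?Lie_valueE.
- rewrite -(om_one phi) -phiact; congr (phi _ _).
  by apply: Lie_ext => Q p hp; rewrite Lie_value_act // Lie_value_one ?Lie_valueE.
- exact: phi0.
- rewrite -ht -hu -(linD (philin X)); congr (phi _ _).
  by apply: Lie_ext => Q p hp; rewrite (linD (Lie_value_linear hp)) !Lie_valueE.
- rewrite -ht -(linZ (philin X)); congr (phi _ _).
  by apply: Lie_ext => Q p hp;
    rewrite (linZ (Lie_value_linear hp)) !Lie_valueE.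
- rewrite -ht -hu -om_comp -phiact; congr (phi _ _).
  by apply: Lie_ext => Q p hp; rewrite Lie_value_act // Lie_value_comp // !Lie_valueE.
Qed.

End LieOperad.

Section FreeModule.
Context {k : fieldType} {W : finType}.

Definition free_module (T : finType) := {ffun T -> k^o}.

Definition fbasis (w : W) : free_module W := [ffun v => (v == w)%:R].

Definition fext (V : lmodType k) (h : W -> V) (a : free_module W) : V :=
  \sum_w a w *: h w.

Lemma fext_linear (V : lmodType k) (h : W -> V) : linear (fext h).
Proof.
move=> c a b; rewrite /fext scaler_sumr -big_split; apply: eq_bigr => w _ /=.
by rewrite !ffunE scalerDl scalerA.
Qed.

Lemma fext_linear2 (U V : lmodType k) (h : W -> U -> V) a :
  (forall w, linear (h w)) -> linear (fun u => fext (fun w => h w u) a).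
Proof.
move=> hl c u v; rewrite /fext scaler_sumr -big_split; apply: eq_bigr => w _ /=.
by rewrite hl scalerDr !scalerA mulrC.
Qed.

Lemma fext_basis (V : lmodType k) (h : W -> V) w : fext h (fbasis w) = h w.
Proof.
rewrite /fext (bigD1 w) //= big1 ?addr0 => [|v vw].
  by rewrite ffunE eqxx scale1r.
by rewrite ffunE (negPf vw) scale0r.
Qed.

Lemma fbasis_decomp (a : free_module W) : a = fext fbasis a.
Proof.
apply/ffunP => v; rewrite sum_ffunE (bigD1 v) //= big1 ?addr0 => [|w wv].
  by rewrite !ffunE eqxx /GRing.scale /= mulr1.
by rewrite !ffunE eq_sym (negPf wv) /GRing.scale /= mulr0.
Qed.

Lemma fext_unique (V : lmodType k) (f g : free_module W -> V) :
  linear f -> linear g -> (forall w, f (fbasis w) = g (fbasis w)) -> f =1 g.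
Proof.
move=> fl gl fg a; rewrite [a]fbasis_decomp /fext (lin_sum fl) (lin_sum gl).
by apply: eq_bigr => w _; rewrite (linZ fl) (linZ gl) fg.
Qed.

End FreeModule.
Arguments free_module : clear implicits.

Lemma linear_comp (k : fieldType) (U V W : lmodType k) (g : V -> W) (f : U -> V) :
  linear g -> linear f -> linear (fun u => g (f u)).
Proof. by move=> gl fl c u v; rewrite fl gl. Qed.

Section CompositeLinear.
Context {k : fieldType} {A B C D E F : smodule k}.
Context {cAB : icomp A B D} {cDC : icomp D C E} {cBC : icomp B C F} {cAF : icomp A F E}.
Hypotheses (hAB : icomp_bilinear cAB) (hDC : icomp_bilinear cDC).
Hypotheses (hBC : icomp_bilinear cBC) (hAF : icomp_bilinear cAF).
Context {X0 X Y Z T V : finType}.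

Lemma comp_act_linear (q : bij X0 (option X)) (r : bij (X + Y) (option T))
    (s : bij (T + Z) V) a b c :
  let f a b c := sm_act s (cDC (sm_act r (cAB (sm_act q a) b)) c) in
  [/\ linear (fun a => f a b c), linear (fun b => f a b c) & linear (f a b)].
Proof.
have [hABl hABr] := hAB X Y; have [hDCl hDCr] := hDC T Z.
split=> z u v; first by rewrite sm_act_linear hABl sm_act_linear hDCl sm_act_linear.
- by rewrite hABr sm_act_linear hDCl sm_act_linear.
- by rewrite hDCr sm_act_linear.
Qed.

Lemma comp_comp_linear (a : A (option X)) (b : B (option Y)) (c : C Z) :
  let f a b c := cAF a (cBC b c) in
  [/\ linear (fun a => f a b c), linear (fun b => f a b c) & linear (f a b)].
Proof.
have [hBCl hBCr] := hBC Y Z; have [hAFl hAFr] := hAF X (Y + Z)%type.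
split=> z u v; first by rewrite hAFl.
- by rewrite hBCl hAFr.
- by rewrite hBCr hAFr.
Qed.

End CompositeLinear.

(* The multilinear monomials in the variables X; there are none when X is
   empty, since the associative algebras are not unital. *)
Definition word (X : finType) := {t : #|X|.-tuple X | uniq t && (0 < #|X|)%N}.

Section SubstSeq.

Definition subst_seq (X Y : Type) (s : seq (option X)) (t : seq Y) :
    seq (X + Y) :=
  flatten [seq if o is Some x then [:: inl x] else map inr t | o <- s].

Lemma subst_seq_cons (X Y : Type) o (s : seq (option X)) (t : seq Y) :
  subst_seq (o :: s) t =
  (if o is Some x then [:: inl x] else map inr t) ++ subst_seq s t.
Proof. by []. Qed.

Lemma subst_seq_map (X Y X' Y' : Type) (f : X -> X') (g : Y -> Y') s t
    (h : X + Y -> X' + Y') :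
  (forall x, h (inl x) = inl (f x)) -> (forall y, h (inr y) = inr (g y)) ->
  subst_seq (map (omap f) s) (map g t) = map h (subst_seq s t).
Proof.
move=> hl hr; elim: s => // -[x|] s IH; rewrite /= !subst_seq_cons /= ?map_cat /= IH ?hl //.
by rewrite -!map_comp; congr (_ ++ _); apply: eq_map => y /=; rewrite hr.
Qed.

Lemma subst_seq_cat (X Y : Type) (s1 s2 : seq (option X)) (t : seq Y) :
  subst_seq (s1 ++ s2) t = subst_seq s1 t ++ subst_seq s2 t.
Proof. by rewrite /subst_seq map_cat flatten_cat. Qed.

Lemma subst_seq_Some (T X Y : Type) (f : T -> X) (s : seq T) (t : seq Y) :
  subst_seq (map (fun x => Some (f x)) s) t = map (fun x => inl (f x)) s.
Proof. by elim: s => //= x s IH; rewrite subst_seq_cons IH. Qed.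

Lemma subst_seq_assoc (X Y Z : Type) (s : seq (option X)) (t : seq (option Y))
    (u : seq Z) :
  map bij_sumA (subst_seq (map bij_sum_optionr (subst_seq s t)) u) =
  subst_seq s (subst_seq t u).
Proof.
elim: s => // -[x|] s IH; first exact: (congr1 (cons (inl x)) IH).
rewrite !subst_seq_cons !map_cat subst_seq_cat map_cat IH; congr (_ ++ _).
rewrite -map_comp; elim: t {s IH} => // -[y|] t IHt.
  exact: (congr1 (cons (inr (inl y))) IHt).
rewrite [in RHS]subst_seq_cons map_cat -IHt -!map_comp.
by rewrite [in LHS]map_cons [in LHS]subst_seq_cons map_cat -!map_comp.
Qed.

Lemma subst_seq_par (X Y Z : Type) (s : seq (option (option X))) (t : seq Y)
    (u : seq Z) :
  map bij_sumAC (subst_seq (map bij_sum_optionl (subst_seq s t)) u) =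
  subst_seq (map bij_sum_optionl (subst_seq (map bij_option_swap s) u)) t.
Proof.
elim: s => // -[[x|]|] s IH.
- exact: (congr1 (cons (inl (inl x))) IH).
- have -> (T : Type) (t' : seq T) : subst_seq (Some None :: s) t' =
      inl None :: subst_seq s t' by [].
  rewrite [in RHS]map_cons.
  have -> (T : Type) s' (t' : seq T) :
      subst_seq (bij_option_swap (Some (@None X)) :: s') t' =
      map inr t' ++ subst_seq s' t' by [].
  rewrite map_cons [in LHS]subst_seq_cons map_cat IH.
  rewrite [in RHS]map_cat [in RHS]subst_seq_cat -!map_comp; congr (_ ++ _).
  by rewrite subst_seq_Some.
- rewrite [in RHS]map_cons.
  have -> (T : Type) s' (t' : seq T) :
      subst_seq (bij_option_swap (@None (option X)) :: s') t' =
      inl None :: subst_seq s' t' by [].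
  rewrite [in RHS]map_cons [in RHS]subst_seq_cons [in LHS]subst_seq_cons.
  rewrite map_cat subst_seq_cat map_cat IH -!map_comp; congr (_ ++ _).
  by rewrite subst_seq_Some -map_comp.
Qed.

End SubstSeq.

Section Words.
Implicit Types X Y Z : finType.

Definition word_tuple X (w : word X) : #|X|.-tuple X := val w.
Definition word_seq X (w : word X) : seq X := word_tuple w.

Lemma word_seq_inj X : injective (@word_seq X).
Proof. by move=> w v e; apply/val_inj/val_inj. Qed.

Lemma word_uniq X (w : word X) : uniq (word_seq w).
Proof. by have /andP[] := valP w. Qed.

Lemma word_size X (w : word X) : size (word_seq w) = #|X|.
Proof. exact: size_tuple. Qed.

Lemma word_card X (w : word X) : (0 < #|X|)%N.
Proof. by have /andP[] := valP w. Qed.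

Definition is_word X (s : seq X) := [&& uniq s, size s == #|X| & (0 < #|X|)%N].

Definition mk_word X (s : seq X) (h : is_word s) : word X :=
  let: And3 us ss c := elimT and3P h in
  exist _ (Tuple ss) (introT andP (conj us c)).

Lemma mk_wordK X (s : seq X) (h : is_word s) : word_seq (mk_word h) = s.
Proof. by rewrite /mk_word; case: (elimT and3P h). Qed.

Lemma word_perm_eq X (w : word X) : perm_eq (word_seq w) (enum X).
Proof.
have u := word_uniq w; apply: uniq_perm; rewrite ?enum_uniq // => x.
rewrite mem_enum inE; apply/negPn/negP => xw.
have : (#|word_seq w| <= #|predC1 x|)%N.
  apply/subset_leq_card/subsetP => y yw; rewrite inE.
  by apply: contraNneq xw => <-.
rewrite (card_uniqP u) word_size cardC1 -ltnS prednK ?ltnn //.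
exact: word_card w.
Qed.

Lemma relabel_word_subproof X Y (f : bij X Y) (w : word X) :
  is_word (map f (word_seq w)).
Proof.
have cXY : #|Y| = #|X|.
  by apply: esym; apply: bij_eq_card; exists (bij_inv f); [exact: bij_funK | exact: bij_invK].
rewrite /is_word map_inj_uniq ?word_uniq; last exact: can_inj (bij_funK f).
by rewrite size_map word_size cXY eqxx word_card.
Qed.

Definition relabel_word X Y (f : bij X Y) (w : word X) : word Y :=
  mk_word (relabel_word_subproof f w).

Lemma subst_word_subproof X Y (w : word (option X)) (v : word Y) :
  is_word (subst_seq (word_seq w) (word_seq v)).
Proof.
have p : perm_eq (subst_seq (word_seq w) (word_seq v))
    (map inr (word_seq v) ++ map inl (enum X)).
  apply: perm_trans (perm_flatten (perm_map _ (word_perm_eq w))) _.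
  rewrite enumT unlock /= perm_cat2l -map_comp /= -enumT.
  by elim: (enum X) => //= x s; rewrite perm_cons.
have c : #|{: X + Y}| = (#|Y| + #|X|)%N by rewrite card_sum addnC.
rewrite /is_word (perm_uniq p) (perm_size p) cat_uniq size_cat !size_map.
rewrite word_size c -enumT -cardE eqxx addn_gt0 (word_card v).
rewrite !map_inj_uniq ?word_uniq ?enum_uniq; try by move=> ? ? [].
rewrite /= -enumT enum_uniq !andbT -all_predC.
by apply/allP => _ /mapP[x _ ->] /=; apply/mapP => -[].
Qed.

(* The monomial w with the monomial v substituted for the variable None. *)
Definition subst_word X Y (w : word (option X)) (v : word Y) : word (X + Y)%type :=
  mk_word (subst_word_subproof w v).

Lemma unit_word_subproof : is_word [:: tt].
Proof. by rewrite /is_word card_unit. Qed.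

Definition unit_word : word unit := mk_word unit_word_subproof.

(* Left multiplication by s, which permutes positions: the letter of the
   result at position i is the letter of w at position s i. *)
Lemma position_word_subproof X (s : 'S_#|X|) (w : word X) :
  is_word [tuple tnth (word_tuple w) (s i) | i < #|X|].
Proof.
apply/and3P; split; [|by rewrite size_tuple|exact: word_card].
rewrite map_inj_uniq ?enum_uniq // => i j.
have x := tnth (word_tuple w) i; rewrite !(tnth_nth x) => /eqP.
by rewrite nth_uniq ?size_tuple ?ltn_ord ?word_uniq // => /eqP /val_inj /perm_inj.
Qed.

Definition position_word X (s : 'S_#|X|) (w : word X) : word X :=
  mk_word (position_word_subproof s w).

End Words.

Section AsOperad.
Variable k : fieldType.

Definition As_mod (X : finType) : lmodType k := free_module k (word X).

Definition As_act (X Y : finType) (f : bij X Y) : As_mod X -> As_mod Y :=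
  fext (fun w => fbasis (relabel_word f w)).

Lemma As_act_linear (X Y : finType) (f : bij X Y) : linear (As_act f).
Proof. exact: fext_linear. Qed.

Lemma As_act_basis (X Y : finType) (f : bij X Y) (w : word X) :
  As_act f (fbasis w) = fbasis (relabel_word f w).
Proof. exact: fext_basis. Qed.

Definition As_smodule : smodule k.
Proof.
exists As_mod As_act; first exact: As_act_linear.
- move=> X; apply: fext_unique; [exact: As_act_linear | by [] | move=> w].
  rewrite As_act_basis; congr fbasis; apply: word_seq_inj.
  by rewrite mk_wordK map_id.
- move=> X Y Z g f; apply: fext_unique; first exact: As_act_linear.
    by apply: linear_comp; exact: As_act_linear.
  move=> w; rewrite !As_act_basis; congr fbasis; apply: word_seq_inj.
  by rewrite !mk_wordK map_comp.
Defined.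

Definition As_one : As_smodule unit := fbasis unit_word.

Definition As_comp : icomp As_smodule As_smodule As_smodule := fun X Y a b =>
  fext (fun w => fext (fun v => fbasis (subst_word w v)) b) a.

Lemma As_comp_bilinear : icomp_bilinear As_comp.
Proof.
move=> X Y; split=> [b|a]; first exact: fext_linear.
by apply: fext_linear2 => w; exact: fext_linear.
Qed.

Lemma As_comp_linearl (X Y : finType) b : linear (fun a => @As_comp X Y a b).
Proof. exact: (As_comp_bilinear X Y).1. Qed.

Lemma As_comp_linearr (X Y : finType) a : linear (@As_comp X Y a).
Proof. exact: (As_comp_bilinear X Y).2. Qed.

Lemma As_comp_basis (X Y : finType) (w : word (option X)) (v : word Y) :
  @As_comp X Y (fbasis w) (fbasis v) = fbasis (subst_word w v).
Proof. by rewrite /As_comp !fext_basis. Qed.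

Lemma As_comp_natural : icomp_natural As_comp.
Proof.
move=> X Y X' Y' f g a b; rewrite /=.
move: a; apply: (@fext_unique k).
- by move=> c u v; rewrite As_act_linear As_comp_linearl.
- by move=> c u v; rewrite As_comp_linearl As_act_linear.
move=> w; move: b; apply: (@fext_unique k).
- by move=> c u v; rewrite As_act_linear As_comp_linearr.
- by move=> c u v; rewrite As_comp_linearr As_act_linear.
move=> v; rewrite !(As_act_basis, As_comp_basis); congr fbasis.
apply: word_seq_inj; rewrite !mk_wordK; exact: subst_seq_map.
Qed.

Lemma As_unitl : icomp_unitl As_one As_comp.
Proof.
move=> Y /=; apply: (@fext_unique k) => //.
  by move=> c u v; rewrite As_comp_linearr As_act_linear.
move=> v; rewrite !(As_act_basis, As_comp_basis); congr fbasis.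
apply: word_seq_inj; rewrite !mk_wordK /subst_seq /= cats0 -map_comp.
by rewrite -[RHS]map_id.
Qed.

Lemma As_unitr : icomp_unitr As_one As_comp.
Proof.
move=> X /=; apply: (@fext_unique k) => //.
  by move=> c u v; rewrite As_comp_linearl As_act_linear.
move=> w; rewrite !(As_act_basis, As_comp_basis); congr fbasis.
apply: word_seq_inj; rewrite !mk_wordK /subst_seq /=.
by elim: (word_seq w) => //= -[x|] s /= ->.
Qed.

Lemma As_seq : icomp_seq As_comp As_comp As_comp As_comp.
Proof.
move=> X Y Z a b c; rewrite -[a in LHS]sm_act_id.
have L a b c := comp_act_linear As_comp_bilinear As_comp_bilinear
  (bij_id (option X)) (@bij_sum_optionr X Y) (@bij_sumA X Y Z) a b c.
have R a b c := @comp_comp_linear _ _ _ _ _ _ _ _ As_comp_bilinear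
  As_comp_bilinear X Y Z a b c.
move: a; apply: (@fext_unique k).
- by have [h _ _] := L 0 b c; exact: h.
- by have [h _ _] := R 0 b c; exact: h.
move=> w; move: b; apply: (@fext_unique k).
- by have [_ h _] := L (fbasis w) 0 c; exact: h.
- by have [_ h _] := R (fbasis w) 0 c; exact: h.
move=> v; move: c; apply: (@fext_unique k).
- by have [_ _ h] := L (fbasis w) (fbasis v) 0; exact: h.
- by have [_ _ h] := R (fbasis w) (fbasis v) 0; exact: h.
move=> u; rewrite sm_act_id /=; do !rewrite ?As_act_basis ?As_comp_basis; congr fbasis.
by apply: word_seq_inj; rewrite !mk_wordK subst_seq_assoc.
Qed.

Lemma As_par : icomp_par As_comp As_comp As_comp As_comp.
Proof.
move=> X Y Z a b c; rewrite -[a in LHS]sm_act_id.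
have L a b c := comp_act_linear As_comp_bilinear As_comp_bilinear
  (bij_id _) (@bij_sum_optionl X Y) (@bij_sumAC X Y Z) a b c.
have R a (b : As_smodule Y) c := comp_act_linear As_comp_bilinear As_comp_bilinear
  (@bij_option_swap X) (@bij_sum_optionl X Z) (bij_id _) a c b.
rewrite -[RHS]sm_act_id; move: a; apply: (@fext_unique k).
- by have [h _ _] := L 0 b c; exact: h.
- by have [h _ _] := R 0 b c; exact: h.
move=> w; move: b; apply: (@fext_unique k).
- by have [_ h _] := L (fbasis w) 0 c; exact: h.
- by have [_ _ h] := R (fbasis w) 0 c; exact: h.
move=> v; move: c; apply: (@fext_unique k).
- by have [_ _ h] := L (fbasis w) (fbasis v) 0; exact: h.
- by have [_ h _] := R (fbasis w) (fbasis v) 0; exact: h.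
move=> u; rewrite !sm_act_id /=; do !rewrite ?As_act_basis ?As_comp_basis; congr fbasis.
by apply: word_seq_inj; rewrite !mk_wordK subst_seq_par.
Qed.

Definition As : operad k :=
  Operad As_comp_bilinear As_comp_natural As_unitl As_unitr As_seq As_par.

End AsOperad.

Section GroupAlgebra.
Context {k : fieldType} {n : nat}.

Definition group_algebra (m : nat) := free_module k 'S_m.

Definition galg_mul (u v : group_algebra n) : group_algebra n :=
  fext (fun s => fext (fun t => fbasis (s * t)%g) v) u.

Definition sigma_seq (A : {set 'I_n}) : seq 'I_n := enum A ++ enum (~: A).

Lemma size_sigma_seq A : size (sigma_seq A) = n.
Proof. by rewrite size_cat -!cardE cardsC card_ord. Qed.

Lemma uniq_sigma_seq A : uniq (sigma_seq A).
Proof.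
rewrite cat_uniq !enum_uniq andbT /=; apply/hasPn => i.
by rewrite !mem_enum inE.
Qed.

Lemma sigma_subproof A : injective (fun i : 'I_n => nth i (sigma_seq A) i).
Proof.
move=> i j; rewrite (set_nth_default i j) ?size_sigma_seq // => /eqP.
by rewrite nth_uniq ?size_sigma_seq ?uniq_sigma_seq // => /eqP /val_inj.
Qed.

(* sigma A lists the elements of A in increasing order, then those of its
   complement (enum 'I_n is increasing). *)
Definition sigma (A : {set 'I_n}) : 'S_n := perm (@sigma_subproof A).

Definition sh_elt : group_algebra n := \sum_(A : {set 'I_n}) fbasis (sigma A).

End GroupAlgebra.
Arguments group_algebra : clear implicits.
Arguments sh_elt : clear implicits.

Section Sh.
Context {k : fieldType}.

Definition position_act (X : finType) (u : group_algebra k #|X|) (a : As k X) :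
    As k X :=
  fext (fun s => fext (fun w => fbasis (position_word s w)) a) u.

(* On 'I_n.+1, As is identified with the group algebra by As_of_galg, and there
   sh is left multiplication by sh_elt: see sh_As_of_galg. *)
Definition sh (X : finType) (a : As k X) : As k X :=
  position_act (sh_elt k #|X|) a.

End Sh.

Section Arity.
Context {k : fieldType} {n : nat}.
Implicit Types s t : 'S_n.+1.

Lemma monomial_subproof s : is_word [seq s i | i <- enum 'I_n.+1].
Proof.
rewrite /is_word map_inj_uniq ?enum_uniq; last exact: perm_inj.
by rewrite size_map -cardE eqxx card_ord.
Qed.

Definition monomial s : word 'I_n.+1 := mk_word (monomial_subproof s).

Definition As_of_galg (u : group_algebra k n.+1) : As k 'I_n.+1 :=
  fext (fun s => fbasis (monomial s)) u.

Lemma As_of_galg_basis s : As_of_galg (fbasis s) = fbasis (monomial s).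
Proof. exact: fext_basis. Qed.

Lemma As_of_galg_linear : linear As_of_galg.
Proof. exact: fext_linear. Qed.

Lemma monomial_bij : bijective monomial.
Proof.
apply: (@inj_card_bij _ _ monomial) => [s t st|].
  apply/permP => i; have := congr1 (fun w => word_seq w) st.
  by rewrite !mk_wordK => /eq_in_map -> //; rewrite mem_enum.
pose g (w : word 'I_n.+1) : {ffun 'I_#|'I_n.+1| -> 'I_n.+1} :=
  [ffun i => tnth (word_tuple w) i].
have gi : injective g.
  move=> w v /ffunP gwv; apply: word_seq_inj; congr val; apply: eq_from_tnth => i.
  by have := gwv i; rewrite !ffunE.
have ginj w : injective (fun i : 'I_n.+1 => g w (enum_rank i)).
  move=> i j; rewrite !ffunE !(tnth_nth ord0) => /eqP.
  rewrite nth_uniq ?size_tuple ?ltn_ord ?word_uniq // => /eqP /val_inj.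
  exact: enum_rank_inj.
apply: (@leq_card _ _ (fun w => perm (ginj w))) => w v /permP wv.
by apply/gi/ffunP => i; have := wv (enum_val i); rewrite !permE enum_valK.
Qed.

Lemma As_of_galg_bij : bijective As_of_galg.
Proof.
have [g gK Kg] := monomial_bij.
exists (fext (fun w => fbasis (g w))).
  apply: fext_unique; [|by []|move=> s].
    by apply: linear_comp; [exact: fext_linear | exact: As_of_galg_linear].
  by rewrite As_of_galg_basis fext_basis gK.
apply: fext_unique; [|by []|move=> w].
  by apply: linear_comp; [exact: As_of_galg_linear | exact: fext_linear].
by rewrite fext_basis As_of_galg_basis Kg.
Qed.

Lemma relabel_monomial s t :
  relabel_word (bij_perm t) (monomial s) = monomial (s * t).
Proof.
apply: word_seq_inj; rewrite !mk_wordK -map_comp.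
by apply: eq_map => i /=; rewrite permM.
Qed.

Lemma sm_act_As_of_galg t (u : group_algebra k n.+1) :
  sm_act (bij_perm t) (As_of_galg u) = As_of_galg (galg_mul u (fbasis t)).
Proof.
move: u; apply: fext_unique.
- by apply: linear_comp; [exact: As_act_linear | exact: As_of_galg_linear].
- by apply: linear_comp; [exact: As_of_galg_linear | exact: fext_linear].
move=> s; rewrite /galg_mul !fext_basis !As_of_galg_basis.
by rewrite [LHS]As_act_basis relabel_monomial.
Qed.

Lemma position_act_linear (X : finType) (a : As k X) :
  linear (fun u => position_act u a).
Proof. exact: fext_linear. Qed.

Lemma sh_As_of_galg (u : group_algebra k n.+1) :
  sh (As_of_galg u) = As_of_galg (galg_mul (sh_elt k n.+1) u).
Proof.
move: u; apply: fext_unique.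
- apply: linear_comp; last exact: As_of_galg_linear.
  by apply: fext_linear2 => s; exact: fext_linear.
- apply: linear_comp; first exact: As_of_galg_linear.
  by apply: fext_linear2 => s; exact: fext_linear.
move=> s; rewrite As_of_galg_basis /sh (lin_sum (position_act_linear _)).
rewrite /galg_mul /sh_elt (lin_sum (fext_linear _)) (lin_sum As_of_galg_linear).
apply/ffunP => v; rewrite !sum_ffunE.
pose f (m : nat) : k := \sum_(A : {set 'I_m})
  (word_seq v == [seq nth ord0 [seq s i | i <- enum 'I_n.+1] (sigma A i)
                 | i <- enum 'I_m])%:R.
transitivity (f #|'I_n.+1|).
  apply: eq_bigr => A _; rewrite /position_act !fext_basis ffunE.
  rewrite -(inj_eq (@word_seq_inj _)) mk_wordK /=; congr ((_ == _)%:R).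
  apply: eq_map => i; rewrite (tnth_nth ord0).
  by rewrite -[tval _]/(word_seq (monomial s)) mk_wordK.
transitivity (f n.+1); first by rewrite card_ord.
apply: eq_bigr => A _; rewrite !fext_basis As_of_galg_basis ffunE.
rewrite -(inj_eq (@word_seq_inj _)) mk_wordK; congr ((_ == _)%:R).
apply: eq_map => i; rewrite permM (nth_map ord0) ?size_enum_ord ?ltn_ord //.
by rewrite nth_ord_enum.
Qed.

End Arity.

Section LieToAs.
Variable k : fieldType.

Definition As_bracket : As k 'I_2 :=
  As_of_galg (fbasis 1%g - fbasis (tperm ord0 ord_max)).

Lemma As_bracketE :
  As_bracket = fbasis (monomial 1%g) - fbasis (monomial (tperm ord0 ord_max)).
Proof.
rewrite /As_bracket -scaleN1r (linD As_of_galg_linear) (linZ As_of_galg_linear).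
by rewrite !As_of_galg_basis scaleN1r.
Qed.

Lemma linB (U V : lmodType k) (f : U -> V) u v :
  linear f -> f (u - v) = f u - f v.
Proof. by move=> fl; rewrite -scaleN1r (linD fl) (linZ fl) scaleN1r. Qed.

Lemma As_bracket_anti :
  sm_act (bij_perm (tperm ord0 ord_max)) As_bracket = - As_bracket.
Proof.
rewrite As_bracketE [LHS](linB _ _ (As_act_linear _)) opprB.
by congr (_ - _); rewrite [LHS]As_act_basis relabel_monomial ?mul1g ?tperm2.
Qed.

Lemma word3P (s : seq 'I_3) : perm_eq (map val s) [:: 0; 1; 2]%N -> is_word s.
Proof.
move=> p; rewrite /is_word -(map_inj_uniq val_inj) (perm_uniq p) card_ord.
by rewrite -(size_map val) (perm_size p).
Qed.

Lemma As_bracket_jacobi :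
  let b := double_bracket As_bracket in
  let cyc := sm_act (s := As k) (bij_ordS 3) in
  b + cyc b + cyc (cyc b) = 0.
Proof.
pose o i : 'I_3 := inord i.
have w123 : is_word [:: o 0; o 1; o 2]%N by apply: word3P; rewrite /= !inordK.
have w213 : is_word [:: o 1; o 0; o 2]%N by apply: word3P; rewrite /= !inordK.
have w312 : is_word [:: o 2; o 0; o 1]%N by apply: word3P; rewrite /= !inordK.
have w321 : is_word [:: o 2; o 1; o 0]%N by apply: word3P; rewrite /= !inordK.
have w231 : is_word [:: o 1; o 2; o 0]%N by apply: word3P; rewrite /= !inordK.
have w132 : is_word [:: o 0; o 2; o 1]%N by apply: word3P; rewrite /= !inordK.
pose e s (w : is_word s) : As k 'I_3 := fbasis (mk_word w).
have cyce s (w : is_word s) s' (w' : is_word s') : map (ordS (n := 3)) s = s' ->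
    As_act (k := k) (bij_ordS 3) (e s w) = e s' w'.
  move=> h; rewrite /e As_act_basis; congr fbasis; apply: word_seq_inj.
  by rewrite !mk_wordK.
have o0 : ordS (o 0%N) = o 1%N by apply: val_inj; rewrite /= !inordK.
have o1 : ordS (o 1%N) = o 2 by apply: val_inj; rewrite /= !inordK.
have o2 : ordS (o 2) = o 0%N by apply: val_inj; rewrite /= !inordK.
have db : double_bracket As_bracket =
    (e _ w123 - e _ w213) - (e _ w312 - e _ w321).
  have lA (X Y : finType) f u v : @As_act k X Y f (u - v) = As_act f u - As_act f v.
    exact: (linB _ _ (As_act_linear _)).
  have lC (X Y : finType) (a a' : As_mod k (option X)) (b b' : As_mod k Y) :
      @As_comp k X Y (a - a') (b - b') =
      (@As_comp k X Y a b - @As_comp k X Y a b') -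
      (@As_comp k X Y a' b - @As_comp k X Y a' b').
    rewrite (linB _ _ (As_comp_linearl _)).
    by congr (_ - _); exact: (linB _ _ (As_comp_linearr _)).
  rewrite /double_bracket As_bracketE.
  rewrite [sm_act (bij_ord_option 1) _]lA [op_comp _ _]lC [LHS]lA.
  rewrite [X in X - _]lA [X in _ - X]lA.
  have bE (t t' : word 'I_2) :
      As_act (bij_compose (bij_sum_ord 2 1) bij_sumC)
        (As_comp (As_act (k := k) (bij_ord_option 1) (fbasis t)) (fbasis t')) =
      fbasis (relabel_word (bij_compose (bij_sum_ord 2 1) bij_sumC)
        (subst_word (relabel_word (bij_ord_option 1) t) t')).
    rewrite [As_act (bij_ord_option 1) _]As_act_basis.
    by rewrite [As_comp _ _]As_comp_basis [LHS]As_act_basis.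
  have e2 : enum 'I_2 = [:: ord0; ord_max].
    by apply: (inj_map val_inj); rewrite val_enum_ord.
  have m1 : word_seq (monomial (n := 1) 1%g) = [:: ord0; ord_max].
    by rewrite mk_wordK e2 /= !perm1.
  have mt : word_seq (monomial (n := 1) (tperm ord0 ord_max)) = [:: ord_max; ord0].
    by rewrite mk_wordK e2 /= tpermL tpermR.
  have bo0 : bij_ord_option 1 ord0 = None by rewrite /= unlift_none.
  have bo1 : bij_ord_option 1 ord_max = Some ord0.
    by rewrite /= (_ : ord_max = lift ord0 ord0) ?liftK //; apply: val_inj.
  have c0 : bij_compose (bij_sum_ord 2 1) bij_sumC (inr ord0) = o 0%N.
    by apply: val_inj; rewrite /= inordK.
  have c1 : bij_compose (bij_sum_ord 2 1) bij_sumC (inr ord_max) = o 1%N.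
    by apply: val_inj; rewrite /= inordK.
  have c2 : bij_compose (bij_sum_ord 2 1) bij_sumC (inl ord0) = o 2.
    by apply: val_inj; rewrite /= inordK.
  have eE s (w : is_word s) (u : word 'I_3) : word_seq u = s -> fbasis u = e s w.
    by move=> us; congr fbasis; apply: word_seq_inj; rewrite mk_wordK.
  have sE (t t' : word 'I_2) : word_seq (relabel_word
      (bij_compose (bij_sum_ord 2 1) bij_sumC)
      (subst_word (relabel_word (bij_ord_option 1) t) t')) =
    map (bij_compose (bij_sum_ord 2 1) bij_sumC)
      (subst_seq (map (bij_ord_option 1) (word_seq t)) (word_seq t')).
    by rewrite !mk_wordK.
  congr (_ - _ - (_ - _)); apply: (etrans (bE _ _)); apply: eE; rewrite sE ?m1 ?mt 2![in subst_seq _ _]map_cons.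
  - by rewrite bo0 bo1 -c0 -c1 -c2.
  - by rewrite bo0 bo1 -c0 -c1 -c2.
  - by rewrite bo0 bo1 -c0 -c1 -c2.
  - by rewrite bo0 bo1 -c0 -c1 -c2.
have lA u v : As_act (k := k) (bij_ordS 3) (u - v) =
    As_act (bij_ordS 3) u - As_act (bij_ordS 3) v.
  exact: (linB _ _ (As_act_linear _)).
move=> b cyc.
have cb : cyc b = (e _ w231 - e _ w321) - (e _ w123 - e _ w132).
  rewrite /cyc /b db [LHS]lA [X in X - _]lA [X in _ - X]lA.
  by congr (_ - _ - (_ - _)); apply: cyce; rewrite /= !(o0, o1, o2).
have ccb : cyc (cyc b) = (e _ w312 - e _ w132) - (e _ w231 - e _ w213).
  rewrite cb /cyc [LHS]lA [X in X - _]lA [X in _ - X]lA.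
  by congr (_ - _ - (_ - _)); apply: cyce; rewrite /= !(o0, o1, o2).
rewrite ccb cb /b db.
move: (e _ w123) (e _ w213) (e _ w312) (e _ w321) (e _ w231) (e _ w132).
by move=> a1 a2 a3 a4 a5 a6; apply/ffunP => v; rewrite !ffunE; ring.
Qed.

Lemma As_bracket_Lie : is_Lie_bracket As_bracket.
Proof. by split; [exact: As_bracket_anti | exact: As_bracket_jacobi]. Qed.

Definition Lie_to_As : operad_mor (Lie k) (As k) := Lie_lift As_bracket_Lie.

Lemma Lie_to_As_gen :
  Lie_to_As _ (Lie_gen k) =
  fbasis (monomial 1%g) - fbasis (monomial (tperm ord0 ord_max)).
Proof. by rewrite -As_bracketE; exact: Lie_lift_gen. Qed.

End LieToAs.

Definition As_Lie_bimodule (k : fieldType) : bimodule (Lie k) :=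
  bimodule_restrict (Lie_to_As k) (operad_bimodule (As k)).

(* Main.v *)
(* On words, sh is the concatenation product after the coproduct for which the
   letters are primitive.  Commutation with the Lie actions is checked on the
   expressions generating Lie.  On the right, a o (t o u) = (a o t) o u reduces
   it to the bracket, which is primitive: the two letters of the bracket either
   stay together, or the terms cancel.  On the left, (t o u) o m is either
   t o (u o m) or (t o m) o u; the latter is handled by compatibility on the
   right, and again only the bracket remains, where m' x m'' cancels in
   sh (x m) - sh (m x) = x (sh m) - (sh m) x. *)
Require Import Defs.
From mathcomp Require Import all_boot all_algebra.
From mathcomp Require Import all_fingroup.
Set Implicit Arguments.
Unset Strict Implicit.
Unset Printing Implicit Defensive.
Import GRing.Theory.
Local Open Scope ring_scope.

(** * Finite sets with a marked point *)

Section Bijections.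

(** Partial composition only inserts at [None]; this lets any chosen input [a] play that role after
    a relabelling. *)
Lemma bij_option_point (A : finType) (a : A) :
  exists (B : finType) (q : bij (option B) A), q None = a.
Proof.
exists {x : A | x != a}.
have inK : cancel (oapp val a) (fun x => insub x : option {x : A | x != a}).
  by case=> [x|] /=; rewrite ?valK // insubF ?eqxx.
have inV : cancel (fun x => insub x : option {x : A | x != a}) (oapp val a).
  by move=> x; case: insubP => [u _ <-|/negPn/eqP].
by exists (Bij inK inV).
Qed.

(** A relabelling of this form only touches the inputs left free by an insertion, so naturality
    moves it outside the composite. *)
Lemma bij_option_None (X Y : Type) (g : bij (option X) (option Y)) :
  g None = None -> exists h : bij X Y, g = bij_option h.
Proof.
move=> gN.
have gS x : {y | g (Some x) = Some y}.
  case e: (g (Some x)) => [y|]; first by exists y.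
  by have := bij_funK g (Some x); rewrite e -gN bij_funK.
have gS' y : {x | bij_inv g (Some y) = Some x}.
  case e: (bij_inv g (Some y)) => [x|]; first by exists x.
  by have := bij_invK g (Some y); rewrite e gN.
have hK : cancel (fun x => sval (gS x)) (fun y => sval (gS' y)).
  move=> x; case: (gS x) => y /= gx; case: (gS' y) => x' /=.
  by rewrite -gx bij_funK => -[].
have hV : cancel (fun y => sval (gS' y)) (fun x => sval (gS x)).
  move=> y; case: (gS' y) => x /= gy; case: (gS x) => y' /=.
  by rewrite -gy bij_invK => -[].
exists (Bij hK hV); apply: Defs.bij_eq => -[x|] //=.
by case: (gS x).
Qed.

End Bijections.

(** * Compatibility with the actions, reduced to the generator [l] *)

Section LieActions.
Context {k : fieldType} {P : operad k} {l : P 'I_2} {F : forall X, P X -> P X}.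
Hypothesis F_mor : is_smodule_mor F.

Let F_linear (X : finType) : linear (@F X) := F_mor.1 X.
Let F_act := F_mor.2.

Definition right_compatible (X : finType) (b : P X) : Prop :=
  forall (Z : finType) (a : P (option Z)), F (op_comp a b) = op_comp (F a) b.

(* Relabelling covers all the inputs of a in which m can be inserted. *)
Definition left_compatible (X : finType) (a : P X) : Prop :=
  forall (Z Y : finType) (f : bij X (option Z)) (m : P Y),
    F (op_comp (sm_act f a) m) = op_comp (sm_act f a) (F m).

Lemma op_comp_actr (X Y Y' : finType) (f : bij Y Y') (a : P (option X)) (b : P Y) :
  op_comp a (sm_act f b) = sm_act (bij_sum (bij_id X) f) (op_comp a b).
Proof.
rewrite -op_natural; congr (op_comp _ _); rewrite -[LHS]sm_act_id.
by congr sm_act; apply: Defs.bij_eq => -[].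
Qed.

Lemma op_comp_actl (X X' Y : finType) (f : bij X X') (a : P (option X)) (b : P Y) :
  op_comp (sm_act (bij_option f) a) b = sm_act (bij_sum f (bij_id Y)) (op_comp a b).
Proof. by rewrite -op_natural sm_act_id. Qed.

Lemma right_compatible_act (X Y : finType) (f : bij X Y) (b : P X) :
  right_compatible b -> right_compatible (sm_act f b).
Proof. by move=> hb Z a; rewrite !op_comp_actr F_act hb. Qed.

Lemma left_compatible_act (X Y : finType) (f : bij X Y) (a : P X) :
  left_compatible a -> left_compatible (sm_act f a).
Proof. by move=> ha Z V g m; rewrite -sm_act_comp ha. Qed.

(** By the unit axiom, inserting the unit is a relabelling, and [F] commutes with relabellings. *)
Lemma right_compatible_one : right_compatible (op_one P).
Proof.
move=> Z a.
have comp1 (c : P (option Z)) :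
    op_comp c (op_one P) = sm_act (bij_sym bij_sum_unit) c.
  rewrite -[in RHS](op_unitr c) -sm_act_comp -[LHS]sm_act_id.
  by congr sm_act; apply: Defs.bij_eq => -[|[]].
by rewrite !comp1 F_act.
Qed.

(** The unit has one input, so [f] must send it to [None] and [Z] is empty; inserting into it is
    then a relabelling. *)
Lemma left_compatible_one : left_compatible (op_one P).
Proof.
move=> Z Y f m.
have [h fh] : exists h : bij void Z, f = bij_compose (bij_option h) bij_unit_option.
  have [|h fh] := @bij_option_None _ _ (bij_compose f (bij_sym bij_unit_option)).
    case e: (f tt) => [z|] /=; last by rewrite e.
    have := bij_invK f None; case: (bij_inv f None); by rewrite e.
  exists h; apply: Defs.bij_eq => -[].
  by have := congr1 (fun g => bij_fun g None) fh.
have comp1 (c : P Y) : op_comp (sm_act f (op_one P)) c =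
    sm_act (bij_compose (bij_sum h (bij_id Y)) (bij_sym bij_void_sum)) c.
  rewrite fh sm_act_comp op_comp_actl sm_act_comp; congr sm_act.
  rewrite -[in RHS](op_unitl c) -sm_act_comp -[LHS]sm_act_id.
  by congr sm_act; apply: Defs.bij_eq => -[].
by rewrite !comp1 F_act.
Qed.

Lemma right_compatible_comp (X Y : finType) (a : P (option X)) (b : P Y) :
  right_compatible a -> right_compatible b -> right_compatible (op_comp a b).
Proof. by move=> ha hb Z c; rewrite -!op_seq F_act hb F_act ha. Qed.

Lemma left_compatible_comp (X Y : finType) (a : P (option X)) (b : P Y) :
  left_compatible a -> left_compatible b -> right_compatible b ->
  left_compatible (op_comp a b).
Proof.
(* The input of the composite that receives [m] is either an input [x] of [a] or an input [y] of
   [b]. *)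
move=> la lb rb Z V f m; case e: (bij_inv f None) => [x|y].
  have [A [q qx]] := bij_option_point x.
  (* [q'] marks [inl x] as [None]; thus [f] is [q'] followed by a bijection fixing [None]. *)
  pose q' := bij_compose (bij_sum_optionl (X := A) (Y := Y))
    (bij_sum (bij_sym q) (bij_id Y)).
  have [|h fh] := @bij_option_None _ _ (bij_compose f (bij_sym q')).
    by rewrite /= qx -e bij_invK.
  have -> : sm_act f (op_comp a b) = sm_act (bij_option h)
      (sm_act bij_sum_optionl
         (op_comp (sm_act (bij_option (bij_sym q)) a) b)).
    rewrite op_comp_actl -!sm_act_comp -fh; congr sm_act.
    by apply: Defs.bij_eq => z; rewrite -[in LHS](bij_funK q' z).
  rewrite !(op_comp_actl h) F_act; congr sm_act.
  (* The parallel axiom makes [b] the outer insertion. Then [rb] moves [F] past [b], and [la]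
     applies to the insertion into [a], the two relabellings of [a] being merged into one. *)
  have par (n : P V) c : op_comp (sm_act bij_sum_optionl (op_comp c b)) n =
      sm_act (bij_sym bij_sumAC) (op_comp (sm_act bij_sum_optionl
        (op_comp (sm_act bij_option_swap c) n)) b).
    rewrite -(op_par c b n) -sm_act_comp -[LHS]sm_act_id.
    by congr sm_act; apply: Defs.bij_eq => z; apply: esym; exact: (bij_funK bij_sumAC z).
  by rewrite !par F_act rb F_act -[sm_act bij_option_swap _]sm_act_comp la.
have [A [q qy]] := bij_option_point y.
pose q' := bij_compose (bij_sum_optionr (X := X) (Y := A))
  (bij_sum (bij_id X) (bij_sym q)).
have [|h fh] := @bij_option_None _ _ (bij_compose f (bij_sym q')).
  by rewrite /= qy -e bij_invK.
have -> : sm_act f (op_comp a b) = sm_act (bij_option h)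
    (sm_act bij_sum_optionr (op_comp a (sm_act (bij_sym q) b))).
  rewrite op_comp_actr -!sm_act_comp -fh; congr sm_act.
  by apply: Defs.bij_eq => z; rewrite -[in LHS](bij_funK q' z).
rewrite !(op_comp_actl h) F_act; congr sm_act.
(* Here [m] goes into [b], and the sequential axiom makes [a] the outer operation. *)
have seq (n : P V) c : op_comp (sm_act bij_sum_optionr (op_comp a c)) n =
    sm_act (bij_sym bij_sumA) (op_comp a (op_comp c n)).
  rewrite -op_seq -sm_act_comp -[LHS]sm_act_id.
  by congr sm_act; apply: Defs.bij_eq => z; apply: esym; exact: (bij_funK bij_sumA z).
have la' (n : P (A + V)%type) : F (op_comp a n) = op_comp a (F n).
  by have := la _ _ (bij_id (option X)) n; rewrite sm_act_id.
by rewrite !seq F_act la' lb.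
Qed.

Hypothesis right_l : right_compatible l.

(** Compatible elements form a subspace that contains [l] and the unit and is stable under
    relabelling and composition. *)
Lemma right_compatible_Lie (X : finType) (t : Lie_term k X) :
  right_compatible (Lie_eval l t).
Proof.
elim: t => {X} [X f|X f|X|X t ht u hu|X c t ht|X m n f t ht u hu] /=.
- exact: right_compatible_act.
- exact/right_compatible_act/right_compatible_one.
- move=> Z a; have [_ lin] := op_bilinear P Z X.
  by rewrite !(lin0 (lin _)) (lin0 (@F_linear _)).
- move=> Z a; have [_ lin] := op_bilinear P Z X.
  by rewrite !(linD (lin _)) (linD (@F_linear _)) ht hu.
- move=> Z a; have [_ lin] := op_bilinear P Z X.
  by rewrite !(linZ (lin _)) (linZ (@F_linear _)) ht.
- exact/right_compatible_act/right_compatible_comp.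
Qed.

Hypothesis left_l : left_compatible l.

Lemma left_compatible_Lie (X : finType) (t : Lie_term k X) :
  left_compatible (Lie_eval l t).
Proof.
elim: t => {X} [X f|X f|X|X t ht u hu|X c t ht|X m n f t ht u hu] /=.
- exact: left_compatible_act.
- exact/left_compatible_act/left_compatible_one.
- move=> Z Y f m; have [lin _] := op_bilinear P Z Y.
  by rewrite sm_act0 (lin0 (lin m)) (lin0 (lin (F m))) (lin0 (@F_linear _)).
- move=> Z Y f m; have [lin _] := op_bilinear P Z Y.
  rewrite (linD (sm_act_linear f)) (linD (lin m)) (linD (lin (F m))).
  by rewrite (linD (@F_linear _)) ht hu.
- move=> Z Y f m; have [lin _] := op_bilinear P Z Y.
  rewrite (linZ (sm_act_linear f)) (linZ (lin m)) (linZ (lin (F m))).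
  by rewrite (linZ (@F_linear _)) ht.
(* Left compatibility of a composite also needs right compatibility of the inserted factor. *)
- apply/left_compatible_act/left_compatible_comp => //.
  exact: right_compatible_Lie.
Qed.

End LieActions.

(** * Unshuffles of a sequence and sums over them *)

Section Unshuffles.

(** The terms of the coproduct with primitive letters. Recursion, rather than indexing by subsets,
    lets sums be expanded one letter at a time. *)
Fixpoint unshuffles (T : Type) (s : seq T) : seq (seq T * seq T) :=
  if s is x :: s' then [seq (x :: p.1, p.2) | p <- unshuffles s'] ++
                       [seq (p.1, x :: p.2) | p <- unshuffles s']
  else [:: ([::], [::])].

Lemma unshuffles_map (T U : Type) (f : T -> U) (s : seq T) :
  unshuffles (map f s) = [seq (map f p.1, map f p.2) | p <- unshuffles s].
Proof.
by elim: s => //= x s ->; rewrite map_cat -!map_comp; congr (_ ++ _); apply: eq_map.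
Qed.

Lemma unshuffles_perm (T : eqType) (s : seq T) p :
  p \in unshuffles s -> perm_eq (p.1 ++ p.2) s.
Proof.
elim: s p => [|x s IH] p /=; first by rewrite inE => /eqP ->.
rewrite mem_cat => /orP[] /mapP[q /IH qs ->] /=; first by rewrite perm_cons.
by rewrite perm_catC /= perm_cons perm_catC.
Qed.

Lemma mem_unshuffles_filter (T : eqType) (a : pred T) (s : seq T) :
  (filter a s, filter (predC a) s) \in unshuffles s.
Proof.
elim: s => //= x s IH; rewrite mem_cat; apply/orP.
by case: (a x) => /=; [left | right]; apply/mapP; exists (filter a s, filter (predC a) s).
Qed.

(** Without repeated letters, the set of letters in the first half determines the whole pair. *)
Lemma unshuffles_filter (T : eqType) (s : seq T) p : uniq s ->
  p \in unshuffles s ->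
  p = (filter (mem p.1) s, filter (predC (mem p.1)) s).
Proof.
elim: s p => [|x s IH] p /=; first by rewrite inE => _ /eqP ->.
case/andP => xs us; rewrite mem_cat => /orP[] /mapP[[a b] qs ->] /=;
  have [ea eb] := IH _ us qs.
  (* Since [x] does not occur in [s], adding it to the predicate does not change the filters of
     [s]. *)
  rewrite inE eqxx /=; congr (_ :: _, _); [rewrite [LHS]ea | rewrite [LHS]eb];
  by apply: eq_in_filter => y ys; rewrite /= inE; case: eqP ys xs => // -> ->.
have -> : x \in a = false.
  apply: contraNF xs => xq; rewrite -(perm_mem (unshuffles_perm qs)).
  by rewrite mem_cat xq.
by congr (_, _ :: _).
Qed.

Lemma unshuffles_uniq (T : eqType) (s : seq T) : uniq s -> uniq (unshuffles s).
Proof.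
elim: s => //= x s IH /andP[xs us]; rewrite cat_uniq !map_inj_uniq ?IH //=;
  try by move=> [? ?] [? ?] [-> ->].
rewrite andbT; apply/hasPn => _ /mapP[p ps ->]; apply: contra xs.
case/mapP => q qs [pq _]; rewrite -(perm_mem (unshuffles_perm ps)).
by rewrite pq mem_cat inE eqxx.
Qed.

(** Links the subsets indexing [sh_elt] with the recursive list: both lists are duplicate-free, and
    [A] is recovered as the set of letters of the first half. *)
Lemma unshuffles_enum (T : finType) :
  perm_eq [seq (enum A, enum (~: A)) | A : {set T}] (unshuffles (enum T)).
Proof.
have eA (A : {set T}) : enum A = filter (mem A) (enum T).
  by rewrite [in RHS]enumT.
apply: uniq_perm; rewrite ?unshuffles_uniq ?enum_uniq //.
  rewrite map_inj_uniq ?enum_uniq // => A B [AB _].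
  by apply/setP => x; rewrite -mem_enum AB mem_enum.
move=> p; apply/imageP/idP => [[A _ ->]|pe].
  rewrite !eA; have -> : filter (mem (~: A)) (enum T) =
      filter (predC (mem A)) (enum T).
    by apply: eq_filter => x; rewrite /= inE.
  exact: mem_unshuffles_filter.
exists [set x in p.1] => //.
rewrite !eA {1}(unshuffles_filter (enum_uniq T) pe); congr (_, _);
by apply: eq_filter => x; rewrite /= !inE.
Qed.

Lemma sum_unshuffles_cons (V : nmodType) (T : Type) (G : seq T -> seq T -> V) x s :
  \sum_(p <- unshuffles (x :: s)) G p.1 p.2 =
  \sum_(p <- unshuffles s) G (x :: p.1) p.2 +
  \sum_(p <- unshuffles s) G p.1 (x :: p.2).
Proof. by rewrite big_cat !big_map. Qed.

(** The definition peels the first letter; monomials ending in a given letter require peeling the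
    last one. *)
Lemma sum_unshuffles_rcons (V : nmodType) (T : Type) (G : seq T -> seq T -> V) s x :
  \sum_(p <- unshuffles (rcons s x)) G p.1 p.2 =
  \sum_(p <- unshuffles s) G (rcons p.1 x) p.2 +
  \sum_(p <- unshuffles s) G p.1 (rcons p.2 x).
Proof.
elim: s G => [|y s IH] G.
  by rewrite [rcons _ _]/= sum_unshuffles_cons !big_seq1.
rewrite rcons_cons sum_unshuffles_cons (IH (fun a b => G (y :: a) b)).
rewrite (IH (fun a b => G a (y :: b))) addrACA.
rewrite (sum_unshuffles_cons (fun a b => G (rcons a x) b)).
by rewrite (sum_unshuffles_cons (fun a b => G a (rcons b x))).
Qed.

(* A bracket is primitive: the unshuffles separating y and z cancel. *)
Lemma sum_unshuffles_subst (V : zmodType) (X Y : Type)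
    (G : seq (X + Y) -> seq (X + Y) -> V) (s1 s2 : seq X) (y z : Y) :
  let s := map Some s1 ++ None :: map Some s2 in
  let D t := \sum_(p <- unshuffles (subst_seq s t)) G p.1 p.2 in
  let E t := \sum_(p <- unshuffles s) G (subst_seq p.1 t) (subst_seq p.2 t) in
  D [:: y; z] - D [:: z; y] = E [:: y; z] - E [:: z; y].
Proof.
(* [G] stays general because peeling [x] replaces it by its composite with prefixing [inl x] to
   either argument. *)
elim: s1 G => [|x s1 IH] G; lazy zeta.
  rewrite [map _ [::]]/= cat0s.
  have E t : \sum_(p <- unshuffles (None :: map Some s2))
      G (subst_seq p.1 t) (subst_seq p.2 t) =
      \sum_(p <- unshuffles (map inl s2)) G (map inr t ++ p.1) p.2 +
      \sum_(p <- unshuffles (map inl s2)) G p.1 (map inr t ++ p.2).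
    rewrite (sum_unshuffles_cons (fun a b => G (subst_seq a t) (subst_seq b t))).
    rewrite !unshuffles_map !big_map; congr (_ + _); apply: eq_bigr => p _ /=;
    by rewrite subst_seq_cons !(subst_seq_Some id).
  (* Two sums keep [a] and [b] together and match [E]; the other two separate them, and their total
     is symmetric in [a] and [b]. *)
  have D a b : \sum_(p <- unshuffles (subst_seq (None :: map Some s2) [:: a; b]))
      G p.1 p.2 = \sum_(p <- unshuffles (map inl s2)) G [:: inr a, inr b & p.1] p.2 +
      \sum_(p <- unshuffles (map inl s2)) G p.1 [:: inr a, inr b & p.2] +
      (\sum_(p <- unshuffles (map inl s2)) G (inr a :: p.1) (inr b :: p.2) +
      \sum_(p <- unshuffles (map inl s2)) G (inr b :: p.1) (inr a :: p.2)).
    have -> : subst_seq (None :: map Some s2) [:: a; b] =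
        [:: inr a, inr b & map inl s2].
      by rewrite subst_seq_cons (subst_seq_Some id).
    rewrite sum_unshuffles_cons.
    rewrite (sum_unshuffles_cons (fun p q => G (inr a :: p) q)).
    rewrite (sum_unshuffles_cons (fun p q => G p (inr a :: q))).
    by rewrite [X in _ + X]addrC addrACA.
  rewrite !E !D [X in _ - (_ + X)]addrC.
  by rewrite opprD addrACA subrr addr0.
have E t : \sum_(p <- unshuffles (Some x :: map Some s1 ++ None :: map Some s2))
    G (subst_seq p.1 t) (subst_seq p.2 t) =
    \sum_(p <- unshuffles (map Some s1 ++ None :: map Some s2))
      G (inl x :: subst_seq p.1 t) (subst_seq p.2 t) +
    \sum_(p <- unshuffles (map Some s1 ++ None :: map Some s2))
      G (subst_seq p.1 t) (inl x :: subst_seq p.2 t).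
  exact: (sum_unshuffles_cons (fun a b => G (subst_seq a t) (subst_seq b t))).
rewrite map_cons cat_cons !E !subst_seq_cons !cat1s !sum_unshuffles_cons !opprD.
rewrite addrACA (IH (fun a b => G (inl x :: a) b)).
by rewrite (IH (fun a b => G a (inl x :: b))) addrACA.
Qed.

End Unshuffles.

(** * The map [sh] on words and the bracket *)

Lemma lin_sum_seq (k : fieldType) (U V : lmodType k) (f : U -> V) :
  linear f -> forall (I : Type) (r : seq I) (G : I -> U),
  f (\sum_(i <- r) G i) = \sum_(i <- r) f (G i).
Proof. by move=> f_lin I r G; exact: (big_morph f (linD f_lin) (lin0 f_lin)). Qed.

Section ShWords.
Context {k : fieldType}.
Implicit Types X Y Z : finType.

(* Zero unless s is a word. *)
Definition word_basis X (s : seq X) : As k X :=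
  [ffun v => (word_seq v == s)%:R] : free_module k (word X).

Lemma fbasisE X (w : word X) : fbasis w = word_basis (word_seq w).
Proof. by apply/ffunP => v; rewrite ffunE. Qed.

Lemma word_basisE X (s : seq X) (h : is_word s) : word_basis s = fbasis (mk_word h).
Proof. by rewrite fbasisE mk_wordK. Qed.

Lemma is_word_perm X (s t : seq X) : perm_eq s t -> is_word s = is_word t.
Proof. by move=> st; rewrite /is_word (perm_uniq st) (perm_size st). Qed.

Lemma word_seq_is_word X (w : word X) : is_word (word_seq w).
Proof. by rewrite /is_word word_uniq word_size eqxx word_card. Qed.

Lemma unshuffles_is_word X (s : seq X) p :
  is_word s -> p \in unshuffles s -> is_word (p.1 ++ p.2).
Proof. by move=> h /unshuffles_perm/is_word_perm ->. Qed.

Lemma act_word_basis X Y (f : bij X Y) (s : seq X) : is_word s ->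
  sm_act f (word_basis s) = word_basis (map f s).
Proof. by move=> h; rewrite word_basisE [LHS]As_act_basis fbasisE !mk_wordK. Qed.

Lemma comp_word_basis X Y (s : seq (option X)) (t : seq Y) :
  is_word s -> is_word t ->
  op_comp (word_basis s) (word_basis t) = word_basis (subst_seq s t).
Proof.
move=> hs ht; rewrite (word_basisE hs) (word_basisE ht) [LHS]As_comp_basis.
by rewrite fbasisE !mk_wordK.
Qed.

Lemma sigma_seqE n (A : {set 'I_n}) :
  [seq sigma A i | i <- enum 'I_n] = sigma_seq A.
Proof.
rewrite -[RHS](map_tnth_enum (Tuple (introT eqP (size_sigma_seq A)))).
by apply: eq_map => i; rewrite permE (tnth_nth i).
Qed.

Lemma sh_linear X : linear (@sh k X).
Proof. by apply: fext_linear2 => s; exact: fext_linear. Qed.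

(** A word is the image of its list of positions, so its unshuffles are the images of those of the
    positions, which correspond to subsets. *)
Lemma sh_word_basis X (s : seq X) : is_word s ->
  sh (word_basis s) = \sum_(p <- unshuffles s) word_basis (p.1 ++ p.2).
Proof.
move=> h; rewrite (word_basisE h) -{2}(mk_wordK h); move: (mk_word h) => w.
rewrite /sh /sh_elt (lin_sum (position_act_linear _)).
have -> : word_seq w = map (tnth (word_tuple w)) (enum 'I_#|X|).
  by rewrite map_tnth_enum.
rewrite unshuffles_map big_map -(perm_big _ (unshuffles_enum _)) big_map big_enum.
apply: eq_bigr => A _; rewrite /position_act !fext_basis fbasisE mk_wordK /=.
by rewrite -map_cat -[enum A ++ _]/(sigma_seq A) -sigma_seqE -[in RHS]map_comp.
Qed.

(** Unshuffling acts on positions and relabelling on letters, so the two commute. *)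
Lemma sh_is_smodule_mor : is_smodule_mor (M := As k) (N := As k) (@sh k).
Proof.
split=> [X|X Y g a]; first exact: sh_linear.
move: a; apply: (@fext_unique k).
- by move=> c u v; rewrite (sm_act_linear (s := As k)) sh_linear.
- by move=> c u v; rewrite sh_linear (sm_act_linear (s := As k)).
move=> w; rewrite fbasisE; have ws := word_seq_is_word w.
rewrite act_word_basis // !sh_word_basis //; last first.
  exact: relabel_word_subproof.
rewrite (lin_sum_seq (sm_act_linear g)) unshuffles_map big_map.
rewrite big_seq [RHS]big_seq; apply: eq_bigr => p ps.
by rewrite act_word_basis ?map_cat //; exact: unshuffles_is_word ps.
Qed.

Lemma As_bracket_word_basis :
  As_bracket k = word_basis [:: ord0; ord_max] - word_basis [:: ord_max; ord0].
Proof.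
have e2 : enum 'I_2 = [:: ord0; ord_max].
  by apply: (inj_map val_inj); rewrite val_enum_ord.
rewrite As_bracketE !fbasisE !mk_wordK e2 /= !perm1 tpermL tpermR.
by [].
Qed.

Lemma is_word_ord2 (i j : 'I_2) : i != j -> is_word [:: i; j].
Proof. by move=> ij; rewrite /is_word card_ord /= inE ij. Qed.

(** In a multilinear monomial the variable [None] occurs exactly once. *)
Lemma word_option_split X (w : word (option X)) :
  exists s1 s2, word_seq w = map Some s1 ++ None :: map Some s2.
Proof.
have wN : None \in word_seq w by rewrite (perm_mem (word_perm_eq w)) mem_enum.
have somes (s : seq (option X)) : None \notin s -> exists t, s = map Some t.
  elim: s => [|[x|] s IH] //=; first by exists [::].
  by rewrite inE => /IH[t ->]; exists (x :: t).
have := word_uniq w; move: (word_seq w) wN => _ /splitPr[p1 p2].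
rewrite cat_uniq /= negb_or => /and3P[_ /andP[N1 _] /andP[N2 _]].
have [s1 ->] := somes _ N1; have [s2 ->] := somes _ N2.
by exists s1, s2.
Qed.

Lemma right_compatible_bracket :
  right_compatible (P := As k) (F := @sh k) (As_bracket k).
Proof.
move=> Z; apply: (@fext_unique k).
- by move=> c u v; rewrite (op_bilinear (As k) _ _).1 sh_linear.
- by move=> c u v; rewrite sh_linear (op_bilinear (As k) _ _).1.
move=> w; rewrite fbasisE; have ws := word_seq_is_word w.
have compr X Y (a : As k (option X)) := (op_bilinear (As k) X Y).2 a.
have compl X Y (b : As k Y) := (op_bilinear (As k) X Y).1 b.
rewrite As_bracket_word_basis !(linB _ _ (compr _ _ _)) (linB _ _ (@sh_linear _)).
have shE (t : seq 'I_2) : is_word t ->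
    sh (op_comp (word_basis (word_seq w)) (word_basis t)) =
    \sum_(p <- unshuffles (subst_seq (word_seq w) t)) word_basis (p.1 ++ p.2).
  move=> ht; rewrite comp_word_basis // sh_word_basis //.
  by have := subst_word_subproof w (mk_word ht); rewrite mk_wordK.
have compE (t : seq 'I_2) : is_word t ->
    op_comp (sh (word_basis (word_seq w))) (word_basis t) =
    \sum_(p <- unshuffles (word_seq w))
      word_basis (subst_seq p.1 t ++ subst_seq p.2 t).
  move=> ht; rewrite sh_word_basis // (lin_sum_seq (compl _ _ _)).
  rewrite big_seq [RHS]big_seq; apply: eq_bigr => p ps.
  (* The halves [p.1] and [p.2] need not be words; only their concatenation is, so the substitution
     is split afterwards, on sequences. *)
  by rewrite comp_word_basis ?subst_seq_cat //; exact: unshuffles_is_word ps.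
rewrite !shE ?compE ?is_word_ord2 //.
have [s1 [s2 ->]] := word_option_split w.
exact: (sum_unshuffles_subst (fun a b => word_basis (a ++ b))).
Qed.

(** The hypothesis forces [z] to be the only element of [Z], so [c] is the bracket with one input
    left free. *)
Lemma sh_commutator Z Y (z : Z) (m : As k Y) : is_word [:: Some z; None] ->
  let c : As k (option Z) :=
    word_basis [:: Some z; None] - word_basis [:: None; Some z] in
  sh (op_comp c m) = op_comp c (sh m).
Proof.
move=> wz c.
have wz' : is_word [:: None; Some z].
  by rewrite -(is_word_perm (_ : perm_eq [:: Some z; None] _)) // (perm_catC [:: _]).
have compr X V (a : As k (option X)) := (op_bilinear (As k) X V).2 a.
have compl X V (b : As k V) := (op_bilinear (As k) X V).1 b.
move: m; apply: (@fext_unique k).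
- by move=> d u v; rewrite compr sh_linear.
- by move=> d u v; rewrite sh_linear compr.
move=> w; rewrite fbasisE; have ws := word_seq_is_word w.
rewrite !(linB _ _ (compl _ _ _)) (linB _ _ (@sh_linear _)).
rewrite !comp_word_basis // !sh_word_basis //; first last.
- by have := subst_word_subproof (mk_word wz) w; rewrite mk_wordK.
- by have := subst_word_subproof (mk_word wz') w; rewrite mk_wordK.
have -> : subst_seq [:: Some z; None] (word_seq w) = inl z :: map inr (word_seq w).
  by rewrite /subst_seq /= cats0.
have -> : subst_seq [:: None; Some z] (word_seq w) =
    rcons (map inr (word_seq w)) (inl z).
  by rewrite /subst_seq /= cats1.
rewrite (sum_unshuffles_cons (fun a b => word_basis (a ++ b))).
rewrite (sum_unshuffles_rcons (fun a b => word_basis (a ++ b))).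
rewrite !(lin_sum_seq (compr _ _ _)) !unshuffles_map !big_map.
(* The sums are paired so that the two with [z] between the halves cancel; those with [z] at an end
   remain. *)
rewrite [X in _ - X]addrC opprD addrACA.
rewrite [X in _ + (X - _)](eq_bigr (fun p => word_basis
  (rcons (map inr p.1) (inl z) ++ map inr p.2))); last first.
  by move=> p _; rewrite cat_rcons.
rewrite subrr addr0; congr (_ - _); rewrite big_seq [RHS]big_seq;
apply: eq_bigr => p ps; rewrite comp_word_basis ?(unshuffles_is_word ws ps) //;
congr word_basis; rewrite /subst_seq /= ?cats0 ?cats1 map_cat //.
by rewrite rcons_cat.
Qed.

Lemma left_compatible_bracket :
  left_compatible (P := As k) (F := @sh k) (As_bracket k).
Proof.
move=> Z Y f m.
rewrite As_bracket_word_basis (linB _ _ (sm_act_linear f)).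
rewrite !act_word_basis ?is_word_ord2 //.
have w01 := relabel_word_subproof f (mk_word (is_word_ord2 (isT : ord0 != ord_max :> 'I_2))).
have w10 := relabel_word_subproof f (mk_word (is_word_ord2 (isT : ord_max != ord0 :> 'I_2))).
rewrite !mk_wordK /= in w01 w10; rewrite ![map f _]/=.
have compl X V (b : As k V) := (op_bilinear (As k) X V).1 b.
(* Exactly one of the two inputs goes to [None]: bijectivity excludes the first and last cases, and
   the middle two differ by a sign. *)
case e: (f ord0) => [z|] in w01 w10 *; case e': (f ord_max) => [z'|] in w01 w10 *.
- have := bij_invK f None; case: (bij_inv f None) => -[|[|//]] i.
    by rewrite (_ : Ordinal i = ord0) ?e //; exact: val_inj.
  by rewrite (_ : Ordinal i = ord_max) ?e' //; exact: val_inj.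
- exact: sh_commutator.
- rewrite -opprB -scaleN1r !(linZ (compl _ _ _)) (linZ (@sh_linear _)).
  by rewrite sh_commutator.
- by have := bij_funK f ord0; rewrite e -e' bij_funK.
Qed.

End ShWords.

Theorem proposition6p1 (k : fieldType) :
  is_bimodule_mor (M := As_Lie_bimodule k) (N := As_Lie_bimodule k)
    (fun X : finType => @sh k X).
Proof.
have right := right_compatible_Lie (sh_is_smodule_mor (k := k))
  (@right_compatible_bracket k).
have left := left_compatible_Lie (sh_is_smodule_mor (k := k))
  (@right_compatible_bracket k) (@left_compatible_bracket k).
split=> [|X Y p m|X Y m p]; first exact: sh_is_smodule_mor.
  (* By definition, [p] acts on [As] through the value at the bracket of its representing
     expression. *)
  have := left _ (Lie_repr p) _ _ (bij_id _) m.
  by rewrite sm_act_id.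
exact: right.
Qed.
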